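(* Let $G$ be a finite simple graph with at least one vertex and let $B\subseteq V(G)$. Then $B$ is a $1$-leaky forcing set of $G$ if and only if for all $v\in V(G)\setminus B$ there exist $x\to v,\ y\to v\in\mathcal F(B)$ with $y\ne x$.
   Context: Zero forcing color change rule: starting from a set of blue vertices (all others white), a blue vertex $u$ may force (color blue) a white vertex $v$ if $v$ is the only white neighbor of $u$; this force is denoted $u\to v$. A leak is a vertex that is not allowed to perform a force. A set $B\subseteq V(G)$ is a $1$-leaky forcing set if for every choice of a single vertex $z\in V(G)$ as a leak, starting with exactly $B$ blue and iteratively applying the color change rule, with $z$ not allowed to force, eventually colors all of $V(G)$ blue. A set of forces (forcing process) $F$ of $B$ in $G$ is a set of forces admitting a chronological ordering such that, starting with exactly $B$ blue, each force is valid when performed (it colors a vertex that is white at that time) and at the end all of $V(G)$ is blue. $\mathcal F(B)$ is the set of all possible forces: $u\to v\in\mathcal F(B)$ if and only if there exists a set of forces $F$ of $B$ in $G$ containing $u\to v$. *)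

(* Defs.v *)
From mathcomp Require Import all_boot.

Set Implicit Arguments.
Unset Strict Implicit.
Unset Printing Implicit Defensive.

(* A finite simple graph is a finType of vertices with a symmetric irreflexive
   adjacency relation [e]; a coloring is its set of blue vertices, and the
   force u -> v is the pair (u, v). *)

Definition can_force (T : finType) (e : rel T) (A : {set T}) (u v : T) : bool :=
  (u \in A) && ([set w | e u w & w \notin A] == [set v]).

(* Starting from the blue set [A], the forces listed in [s] are performed one
   after the other, each valid when performed, none by a vertex of the leak
   set [L], and at the end every vertex is blue. *)
Fixpoint chronological (T : finType) (e : rel T) (L A : {set T})
    (s : seq (T * T)) : bool :=
  match s with
  | [::] => A == [set: T]
  | (u, v) :: s' =>
      [&& u \notin L, can_force e A u v & chronological e L (v |: A) s']
  end.

(* Blue vertices stay blue, so a force that is available to a non-leak remains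
   available until its target is blue: whether everything eventually becomes
   blue does not depend on the order of the forces. *)
Definition one_leaky_forcing (T : finType) (e : rel T) (B : {set T}) : Prop :=
  forall z : T, exists s : seq (T * T), chronological e [set z] B s.

Definition set_of_forces (T : finType) (e : rel T) (B : {set T})
    (F : {set T * T}) : Prop :=
  exists2 s : seq (T * T), perm_eq s (enum F) & chronological e set0 B s.

(* [possible_force e B u v] says that u -> v belongs to $\mathcal F(B)$. *)
Definition possible_force (T : finType) (e : rel T) (B : {set T})
    (u v : T) : Prop :=
  exists2 F : {set T * T}, set_of_forces e B F & (u, v) \in F.

(* Main.v *)
Require Import Defs.
From mathcomp Require Import all_boot.

Set Implicit Arguments.
Unset Strict Implicit.
Unset Printing Implicit Defensive.

(* For sufficiency, let C be a stalled proper set reached from B with leak z.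
   The first force leaving C in any forcing process of B is still valid at C,
   so it is performed by z, and its target is the unique white neighbor v of z.
   Hence z forces v in every forcing process of B, and v is forced only once
   in each of them, so no other vertex can ever force v. *)

Lemma can_force_white (T : finType) (e : rel T) (A : {set T}) (u v : T) :
  can_force e A u v -> v \notin A.
Proof. by case/andP=> _ /eqP/setP/(_ v); rewrite !inE eqxx => /andP[]. Qed.

Lemma can_force_target_inj (T : finType) (e : rel T) (A : {set T})
    (u v w : T) : can_force e A u v -> can_force e A u w -> v = w.
Proof. by case/andP=> _ /eqP Wv /andP[_]; rewrite Wv => /eqP/set1_inj. Qed.

Lemma can_force_superset (T : finType) (e : rel T) (A C : {set T}) (u v : T) :
  A \subset C -> v \notin C -> can_force e A u v -> can_force e C u v.
Proof.
move=> sAC vNC /andP[uA /eqP/setP Wv]; rewrite /can_force (subsetP sAC) //=.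
apply/eqP/setP=> w; have := Wv w; rewrite !inE.
have [-> | _] := eqVneq w v; first by rewrite vNC => /andP[-> _].
by case: (e u w) => //= /negbFE/(subsetP sAC)->.
Qed.

Lemma chronological_weaken (T : finType) (e : rel T) (L L' A : {set T})
    (s : seq (T * T)) :
  L' \subset L -> chronological e L A s -> chronological e L' A s.
Proof.
move=> sL; elim: s A => [|[u v] s IHs] A //= /and3P[uNL -> /IHs->].
by rewrite (contra (subsetP sL u) uNL).
Qed.

Lemma chronological_target_white (T : finType) (e : rel T) (L A : {set T})
    (s : seq (T * T)) (u v : T) :
  chronological e L A s -> (u, v) \in s -> v \notin A.
Proof.
elim: s A => [|[u' v'] s IHs] A //= /and3P[_ force_v' chr_s].
rewrite inE => /predU1P[[_ ->] | /(IHs _ chr_s)].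
  exact: can_force_white force_v'.
by rewrite !inE negb_or => /andP[].
Qed.

Lemma chronological_source_unique (T : finType) (e : rel T) (L A : {set T})
    (s : seq (T * T)) (x y v : T) :
  chronological e L A s -> (x, v) \in s -> (y, v) \in s -> x = y.
Proof.
elim: s A => [|[u w] s IHs] A //= /and3P[_ _ chr_s].
have fresh z : (z, w) \notin s.
  by apply/negP=> /(chronological_target_white chr_s); rewrite setU11.
rewrite !inE => /predU1P[[-> ->] | xv_s] /predU1P[[] // -> | yv_s].
- by rewrite (negPf (fresh y)) in yv_s.
- by move=> wv; rewrite wv (negPf (fresh x)) in xv_s.
- exact: IHs chr_s xv_s yv_s.
Qed.

Lemma chronological_uniq (T : finType) (e : rel T) (L A : {set T})
    (s : seq (T * T)) : chronological e L A s -> uniq s.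
Proof.
elim: s A => [|[u v] s IHs] A //= /and3P[_ _ chr_s].
rewrite (IHs _ chr_s) andbT; apply/negP.
by move/(chronological_target_white chr_s); rewrite setU11.
Qed.

Lemma chronological_forces_white (T : finType) (e : rel T) (L A : {set T})
    (s : seq (T * T)) (v : T) :
  chronological e L A s -> v \notin A ->
  exists2 u, u \notin L & (u, v) \in s.
Proof.
elim: s A => [|[u w] s IHs] A /=; first by move/eqP->; rewrite inE.
case/and3P=> uNL _ chr_s vNA.
have [-> | v_neq_w] := eqVneq v w; first by exists u; rewrite ?mem_head.
have [|u' u'NL u'v_s] := IHs _ chr_s; first by rewrite !inE negb_or v_neq_w.
by exists u'; rewrite ?inE ?u'v_s ?orbT.
Qed.

Lemma chronological_exits (T : finType) (e : rel T) (L A C : {set T})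
    (s : seq (T * T)) :
  chronological e L A s -> A \subset C -> C != [set: T] ->
  exists u v, (u, v) \in s /\ can_force e C u v.
Proof.
move=> chr_s sAC CNT; elim: s A sAC chr_s => [|[u v] s IHs] A sAC /=.
  by move/eqP=> AT; rewrite -subTset -AT sAC in CNT.
case/and3P=> _ force_v chr_s.
have [vC | vNC] := boolP (v \in C).
  have [|u' [v' [uv_s force_v']]] := IHs (v |: A) _ chr_s.
    by rewrite subUset sub1set vC.
  by exists u', v'; rewrite inE uv_s orbT.
by exists u, v; rewrite mem_head; split=> //; apply: can_force_superset force_v.
Qed.

Lemma chronological_or_stalled (T : finType) (e : rel T) (L A : {set T}) :
  (exists s, chronological e L A s) \/
  exists C : {set T}, [/\ A \subset C, C != [set: T]
    & forall u v, can_force e C u v -> u \in L].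
Proof.
have [n] := ubnP #|~: A|; elim: n A => // n IHn A; rewrite ltnS => leAn.
have [AT | ANT] := eqVneq A [set: T].
  by left; exists [::]; rewrite /= AT.
have [/existsP[[u v] /= /andP[uNL force_v]] | stalled] :=
  boolP [exists p : T * T, (p.1 \notin L) && can_force e A p.1 p.2]; last first.
  right; exists A; split=> // u v force_v; apply: contraR stalled => uNL.
  by apply/existsP; exists (u, v); rewrite /= uNL.
have [|[s chr_s] | [C [sAC CNT stalled]]] := IHn (v |: A).
- apply: leq_trans leAn; apply: proper_card.
  rewrite properC properE subsetUr /= subUset sub1set.
  by rewrite (negPf (can_force_white force_v)).
- by left; exists ((u, v) :: s); rewrite /= uNL force_v.
- right; exists C; split=> //.
  by apply: subset_trans sAC; apply: subsetUr.
Qed.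

Lemma possible_forceP (T : finType) (e : rel T) (B : {set T}) (u v : T) :
  possible_force e B u v <->
  exists2 s, chronological e set0 B s & (u, v) \in s.
Proof.
split=> [[F [s s_F chr_s] uv_F] | [s chr_s uv_s]].
  by exists s; rewrite // (perm_mem s_F) mem_enum.
exists [set p in s]; last by rewrite inE.
exists s => //; apply: uniq_perm; rewrite ?enum_uniq //.
  exact: chronological_uniq chr_s.
by move=> p; rewrite mem_enum inE.
Qed.

Lemma leaky_possible_force (T : finType) (e : rel T) (B : {set T}) (z v : T) :
  one_leaky_forcing e B -> v \notin B ->
  exists2 x, x <> z & possible_force e B x v.
Proof.
move=> /(_ z)[s chr_s] vNB.
have [x xNz xv_s] := chronological_forces_white chr_s vNB.
exists x; first by apply/eqP; rewrite inE in xNz.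
apply/possible_forceP; exists s => //.
exact: chronological_weaken (sub0set _) chr_s.
Qed.

Theorem theorem2p3 (T : finType) (e : rel T) (e_sym : symmetric e)
    (e_irr : irreflexive e) (T_gt0 : 0 < #|T|) (B : {set T}) :
  one_leaky_forcing e B <->
  (forall v : T, v \notin B ->
     exists x y : T,
       [/\ possible_force e B x v, possible_force e B y v & y <> x]).
Proof.
split=> [leaky v vNB | two_forces z].
  have [x _ xv] := leaky_possible_force v leaky vNB.
  have [y y_neq_x yv] := leaky_possible_force x leaky vNB.
  by exists x, y.
have [//|[C [sBC CNT stalled]]] := chronological_or_stalled e [set z] B.
have z_exits s : chronological e set0 B s ->
    exists2 v, (z, v) \in s & can_force e C z v.
  move=> chr_s.
  have [u [v [uv_s force_v]]] := chronological_exits chr_s sBC CNT.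
  by have /set1P <- := stalled u v force_v; exists v.
have notin_B w : w \notin C -> w \notin B by apply/contra/(subsetP sBC).
have [w wNC] : exists w, w \notin C.
  by apply/existsP; rewrite -negb_forall; apply: contra CNT => /forallP CT;
    apply/eqP/setP=> w; rewrite CT inE.
have [_ [_ [/possible_forceP[s0 chr_s0 _] _ _]]] := two_forces w (notin_B w wNC).
have [v _ force_v] := z_exits s0 chr_s0.
have forced_by_z x : possible_force e B x v -> x = z.
  case/possible_forceP=> s chr_s xv_s; have [v' zv' force_v'] := z_exits s chr_s.
  rewrite -(can_force_target_inj force_v force_v') in zv'.
  exact: chronological_source_unique chr_s xv_s zv'.
have vNC := can_force_white force_v.
have [x [y [/forced_by_z-> /forced_by_z-> //]]] := two_forces v (notin_B v vNC).
Qed.
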